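(* Let $G$ be a connected graph on $N\ge 2$ vertices and let its vertex set be partitioned into two non-empty parts, one held by Alice and one held by Bob. Let $\rho_2$ be a two-qubit state shared between Alice and Bob. Suppose that from sufficiently many copies of $\rho_2$, Alice and Bob can produce, by stochastic local operations and classical communication (SLOCC) with respect to the Alice/Bob split (using additional local ancilla qubits if needed), the noisy $N$-qubit graph state $\rho_G$, where Alice holds the qubits of her part and Bob the qubits of his. If $\rho_2$ cannot be purified (distilled) to a maximally entangled two-qubit state, then $\rho_G$ cannot be purified to the pure graph state $|\psi_G\rangle$ by any protocol.
   Context: For a graph $G$ with vertices $V_G$ and edges $E_G$, attach a qubit to each vertex. The graph state $|\psi_G\rangle$ is the unique common $+1$ eigenstate of the stabilizers $K_i=X_i\prod_{\{i,j\}\in E_G}Z_j$, $i\in V_G$; equivalently, it is obtained by preparing every qubit in $|+\rangle=(|0\rangle+|1\rangle)/\sqrt2$ and applying a controlled-phase gate along every edge. The states $Z_j|\psi_G\rangle$, $j\in\{0,1\}^N$ (where $Z_j$ applies $Z$ to the qubits indicated by $j$) form an orthonormal basis, the graph-state basis. A noisy graph state is a mixed state $\rho_G=\sum_j\lambda_j Z_j|\psi_G\rangle\langle\psi_G|Z_j$. Purification of an $N$-qubit state $\rho$ to a pure target $|\psi\rangle$ means: each qubit is held by a different party, each party holds the corresponding qubit of every one of arbitrarily many copies of $\rho$, and the parties, restricted to (perfect) SLOCC, produce at least one copy of $|\psi\rangle$ with fidelity arbitrarily close to 1. Purification of a two-qubit state means purification to a maximally entangled (Bell) state. *)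

(* Defs.v *)
From HB Require Import structures.
From mathcomp Require Import all_boot all_order all_algebra.
From mathcomp Require Import reals Rstruct complex.
Set Implicit Arguments. Unset Strict Implicit. Unset Printing Implicit Defensive.
Import Order.TTheory GRing.Theory Num.Theory.
Local Open Scope ring_scope.

Notation C := (Rdefinitions.R[i]).

(* Qubits are labelled by a finite type Q; computational basis states are
   bit-assignments Q -> bool. *)
Definition basis (Q : finType) := {ffun Q -> bool}.
Definition vec (Q : finType) := basis Q -> C.
(* linear operators from the qubits Qin to the qubits Qout (matrix entries
   <b_out| K |b_in>) *)
Definition op (Qin Qout : finType) := basis Qout -> basis Qin -> C.

Definition is_density (Q : finType) (rho : op Q Q) : Prop :=
  (forall v : vec Q,
     0 <= \sum_(b : basis Q) \sum_(b' : basis Q) (v b)^* * rho b b' * v b') /\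
  \sum_(b : basis Q) rho b b = 1.

Definition expval (Q : finType) (psi : vec Q) (sigma : op Q Q) : C :=
  \sum_(b : basis Q) \sum_(b' : basis Q) (psi b)^* * sigma b b' * psi b'.

(* n copies: qubit (q, k) is qubit q of copy k *)
Definition slice (Q : finType) (n : nat) (b : basis (Q * 'I_n)%type) (k : 'I_n)
  : basis Q := [ffun q => b (q, k)].
Definition copies (Q : finType) (rho : op Q Q) (n : nat)
  : op (Q * 'I_n)%type (Q * 'I_n)%type :=
  fun b b' => \prod_(k < n) rho (slice b k) (slice b' k).
Arguments copies {Q} rho n.

Definition restr (P Q : finType) (pi : Q -> P) (p : P) (b : basis Q)
  : basis {x : Q | pi x == p} := [ffun x => b (sval x)].

(* An operator is local w.r.t. the party assignments pin (input qubits) and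
   pout (output qubits) if it is a tensor product over the parties of
   operators acting on each party's qubits (input and output dimensions of a
   party may differ: this covers local ancillas and discarding). *)
Definition local_op (P Qin Qout : finType) (pin : Qin -> P) (pout : Qout -> P)
  (K : op Qin Qout) : Prop :=
  exists A : forall p : P, op {x : Qin | pin x == p} {y : Qout | pout y == p},
    forall bo bi, K bo bi = \prod_(p : P) A p (restr pout p bo) (restr pin p bi).

Definition kraus_apply (Qin Qout : finType) (m : nat) (Ks : 'I_m -> op Qin Qout)
  (rho : op Qin Qin) : op Qout Qout :=
  fun bo bo' => \sum_(k < m) \sum_(bi : basis Qin) \sum_(bi' : basis Qin)
                  Ks k bo bi * rho bi bi' * (Ks k bo' bi')^*.

(* sigma is obtained from rho by (perfect) SLOCC w.r.t. the party
   assignments: the successful branch of a stochastic local protocol with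
   classical communication, i.e. a separable CP map (finitely many product
   Kraus operators) followed by renormalisation, succeeding with nonzero
   probability. *)
Definition slocc_output (P Qin Qout : finType) (pin : Qin -> P)
  (pout : Qout -> P) (rho : op Qin Qin) (sigma : op Qout Qout) : Prop :=
  exists (m : nat) (Ks : 'I_m -> op Qin Qout),
    (forall k, local_op pin pout (Ks k)) /\
    let t := \sum_(b : basis Qout) kraus_apply Ks rho b b in
    t != 0 /\ forall bo bo', sigma bo bo' = kraus_apply Ks rho bo bo' / t.

(* Purification of rho (on qubits Q, each qubit held by a different party)
   to the pure target psi: for every eps > 0 there are a number n of copies
   and an SLOCC protocol producing a state of fidelity >= 1 - eps with psi. *)
Definition purifiable (Q : finType) (rho : op Q Q) (psi : vec Q) : Prop :=
  forall eps : C, 0 < eps ->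
    exists (n : nat) (sigma : op Q Q),
      slocc_output (fun x : (Q * 'I_n)%type => x.1) (fun q : Q => q)
        (copies rho n) sigma /\
      1 - eps <= expval psi sigma.

Definition bell : vec bool :=
  fun b => if b false == b true then (sqrtC 2)^-1 else 0.

Definition edges (V : finType) (e : rel V) : {set {set V}} :=
  [set E : {set V} | [exists x, exists y, e x y && (E == [set x; y])]].

(* Graph state: |+>^N followed by a controlled-phase on every edge. *)
Definition graph_state (V : finType) (e : rel V) : vec V :=
  fun b => ((sqrtC 2) ^+ #|V|)^-1 *
           \prod_(E in edges e) (if [forall x in E, b x] then -1 else 1).

Definition zsign (V : finType) (j b : basis V) : C :=
  (-1) ^+ #|[set i | j i && b i]|.

(* Noisy graph state sum_j lam_j Z_j |psi_G><psi_G| Z_j *)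
Definition noisy_graph_state (V : finType) (e : rel V) (lam : basis V -> C)
  : op V V :=
  fun b b' => \sum_(j : basis V)
     lam j * (zsign j b * graph_state e b) * (zsign j b' * graph_state e b')^*.

(* Main.v *)
Require Import Defs.
From HB Require Import structures.
From mathcomp Require Import all_boot all_order all_algebra.
From mathcomp Require Import ring.
From mathcomp Require Import reals Rstruct complex.
Import Order.TTheory GRing.Theory Num.Theory.
Local Open Scope ring_scope.

Set Implicit Arguments.
Unset Strict Implicit.
Unset Printing Implicit Defensive.

(** Were [rho_G] purifiable, [rho2] would be purifiable too.  Prepare many copies of
    [rho_G] from copies of [rho2] and purify them to a state close to [|psi_G>]: a
    protocol local to every qubit is in particular local for Alice and Bob.
    Connectedness gives an edge [x y] crossing the cut; projecting every qubit other
    than [x], [y] onto [|0>] leaves the graph state of that single edge, which a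
    Hadamard on [y] turns into the Bell state.  This filter maps [|psi_G>] exactly to a
    nonzero multiple of the Bell state, so by a norm estimate the output fidelity tends
    to 1 with the input fidelity; the estimate is carried out on an unnormalised
    ensemble [sum_i |w_i><w_i|], which noisy graph states, copies and SLOCC outputs
    all admit. *)

(** * Local operators and their closure properties *)

Definition agree (P Q : finType) (pi : Q -> P) (p : P) (b b' : basis Q) :=
  forall x, pi x = p -> b x = b' x.

(** Lets each factor act on whole registers while reading only its party's bits, so that no
    dependent types of restricted assignments occur below. *)
Lemma local_opP (P Qin Qout : finType) (pin : Qin -> P) (pout : Qout -> P)
    (K : op Qin Qout) :
  local_op pin pout K <->
  exists A : P -> op Qin Qout,
    (forall p bo bo' bi bi', agree pout p bo bo' -> agree pin p bi bi' ->
       A p bo bi = A p bo' bi') /\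
    forall bo bi, K bo bi = \prod_p A p bo bi.
Proof.
split=> [[A KE]|[A [Aloc KE]]].
  exists (fun p bo bi => A p (restr pout p bo) (restr pin p bi)).
  split=> // p bo bo' bi bi' Ho Hi.
  by congr (A p _ _); apply/ffunP=> -[x Hx]; rewrite !ffunE /=;
    [apply: Ho | apply: Hi]; apply/eqP.
(* Bits of other parties are filled with [false]; any value would do, since [Aloc] makes the factor
   of [p] blind to them. *)
pose ext (Q : finType) (pi : Q -> P) p (b : basis {x : Q | pi x == p}) : basis Q :=
  [ffun x => if insub x is Some u then b u else false].
have extP (Q : finType) (pi : Q -> P) p b :
    agree pi p b (ext Q pi p (restr pi p b)).
  by move=> x Hx; rewrite ffunE insubT ?Hx //= => Hx'; rewrite ffunE SubK.
exists (fun p bo bi => A p (ext Qout pout p bo) (ext Qin pin p bi)) => bo bi.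
by rewrite KE; apply: eq_bigr => p _; apply: Aloc; apply: extP.
Qed.

Definition comp_op (Q1 Q2 Q3 : finType) (L : op Q2 Q3) (K : op Q1 Q2) : op Q1 Q3 :=
  fun bo bi => \sum_bm L bo bm * K bm bi.

(** An intermediate assignment is an independent choice of bits by each party, so the sum of
    products over parties is a product of local sums. *)
Lemma local_comp_op (P Q1 Q2 Q3 : finType) (p1 : Q1 -> P) (p2 : Q2 -> P)
    (p3 : Q3 -> P) (L : op Q2 Q3) (K : op Q1 Q2) :
  local_op p2 p3 L -> local_op p1 p2 K -> local_op p1 p3 (comp_op L K).
Proof.
move=> /local_opP [A [Aloc LE]] /local_opP [B [Bloc KE]]; apply/local_opP.
(* Assignments vanishing outside party [p] represent the local ones, each exactly once. *)
pose sup p (b : basis Q2) := [forall x, b x ==> (p2 x == p)].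
pose mask p (b : basis Q2) : basis Q2 := [ffun x => (p2 x == p) && b x].
have maskP p b : agree p2 p b (mask p b) by move=> x /eqP Hx; rewrite ffunE Hx.
have refl (Q : finType) (pi : Q -> P) p b : agree pi p b b by [].
exists (fun p bo bi => \sum_(b | sup p b) A p bo b * B p b bi); split.
  move=> p bo bo' bi bi' Ho Hi; apply: eq_bigr => b _.
  by rewrite (Aloc p bo bo' b b) // (Bloc p b b bi bi').
move=> bo bi; rewrite bigA_distr_big_dep /=.
(* A family of local assignments is glued by reading each bit from the component of its owner. *)
rewrite (reindex_onto (fun b : basis Q2 => [ffun p => mask p b])
   (fun f : {ffun P -> basis Q2} => [ffun x => f (p2 x) x])) /=.
  apply: eq_big => [b|b _].
    symmetry; apply/andP; split.
      by apply/familyP=> p; rewrite ffunE; apply/forallP=> x; rewrite ffunE;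
         apply/implyP=> /andP[].
    by apply/eqP/ffunP=> x; rewrite !ffunE eqxx.
  rewrite LE KE -big_split /=; apply: eq_bigr => p _; rewrite ffunE.
  by rewrite (Aloc p bo bo _ (mask p b)) // (Bloc p _ (mask p b) bi bi).
move=> f /familyP Hf; apply/ffunP=> p; apply/ffunP=> x; rewrite !ffunE.
have := Hf p; rewrite unfold_in => /forallP/(_ x).
case: (p2 x =P p) => [->//|_] /=.
by rewrite implybF => /negbTE ->.
Qed.

(** Merging parties along [g] groups the factors by fibre; this turns locality at every qubit into
    locality for Alice and Bob. *)
Lemma local_coarse (P P' Qin Qout : finType) (g : P -> P') (pin : Qin -> P)
    (pout : Qout -> P) (K : op Qin Qout) :
  local_op pin pout K -> local_op (g \o pin) (g \o pout) K.
Proof.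
move=> /local_opP [A [Aloc KE]]; apply/local_opP.
exists (fun p' bo bi => \prod_(p | g p == p') A p bo bi); split.
  move=> p' bo bo' bi bi' Ho Hi; apply: eq_bigr => p /eqP Hp.
  by apply: Aloc => x Hx; [apply: Ho | apply: Hi]; rewrite /= Hx.
by move=> bo bi; rewrite KE (partition_big g predT).
Qed.

Definition tensor_op (Qin Qout : finType) (n : nat) (Ks : 'I_n -> op Qin Qout) :
    op (Qin * 'I_n)%type (Qout * 'I_n)%type :=
  fun bo bi => \prod_k Ks k (slice bo k) (slice bi k).

Lemma local_tensor_op (P Qin Qout : finType) (pin : Qin -> P) (pout : Qout -> P)
    (n : nat) (Ks : 'I_n -> op Qin Qout) :
  (forall k, local_op pin pout (Ks k)) ->
  local_op (fun x : (Qin * 'I_n)%type => pin x.1)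
    (fun x : (Qout * 'I_n)%type => pout x.1) (tensor_op Ks).
Proof.
move=> Kloc.
have /(@fin_all_exists _ (fun=> _) (fun=> _)) [A HA] k := (local_opP pin pout (Ks k)).1 (Kloc k).
apply/local_opP; exists (fun p bo bi => \prod_k A k p (slice bo k) (slice bi k)).
split=> [p bo bo' bi bi' Ho Hi|bo bi].
  apply: eq_bigr => k _; apply: (HA k).1 => x Hx; rewrite !ffunE.
    exact: Ho.
  exact: Hi.
by rewrite exchange_big; apply: eq_bigr => k _; rewrite (HA k).2.
Qed.

(** * SLOCC protocols: composition, parallel repetition and relabelling *)

Definition kraus (I Qin Qout : finType) (Ks : I -> op Qin Qout) (rho : op Qin Qin) :
    op Qout Qout :=
  fun bo bo' => \sum_k \sum_bi \sum_bi' Ks k bo bi * rho bi bi' * (Ks k bo' bi')^*.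

Lemma eq_kraus (I Qin Qout : finType) (Ks : I -> op Qin Qout) (rho rho' : op Qin Qin) :
  (forall b b', rho b b' = rho' b b') ->
  forall bo bo', kraus Ks rho bo bo' = kraus Ks rho' bo bo'.
Proof.
move=> H bo bo'; apply: eq_bigr => k _; apply: eq_bigr => b _.
by apply: eq_bigr => b' _; rewrite H.
Qed.

(** Any finite type may index the Kraus operators, so pairs and functions can serve later. The
    constant [c] is free because unit trace forces it to be the inverse of the success weight. *)
Lemma slocc_outputI (I P Qin Qout : finType) (pin : Qin -> P) (pout : Qout -> P)
    (rho : op Qin Qin) (sigma : op Qout Qout) (Ks : I -> op Qin Qout) (c : C) :
  (forall k, local_op pin pout (Ks k)) ->
  (forall bo bo', sigma bo bo' = c * kraus Ks rho bo bo') ->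
  \sum_b sigma b b = 1 ->
  slocc_output pin pout rho sigma.
Proof.
move=> Kloc sigmaE tr1.
exists #|I|, (fun k : 'I_#|{: I}| => Ks (enum_val k)); split=> // t.
have KE bo bo' : kraus_apply (fun k : 'I_#|{: I}| => Ks (enum_val k)) rho bo bo' = kraus Ks rho bo bo'.
  by rewrite /kraus (reindex _ (onW_bij _ (@enum_val_bij I))).
have ct : c * t = 1.
  by rewrite -tr1 mulr_sumr; apply: eq_bigr => b _; rewrite sigmaE KE.
have t0 : t != 0 by apply: contra_eq_neq ct => ->; rewrite mulr0 eq_sym oner_neq0.
split=> // bo bo'; rewrite sigmaE KE mulrC; congr (_ * _).
by apply: (mulIf t0); rewrite ct mulVf.
Qed.

Lemma slocc_outputE (P Qin Qout : finType) (pin : Qin -> P) (pout : Qout -> P)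
    (rho : op Qin Qin) (sigma : op Qout Qout) :
  slocc_output pin pout rho sigma ->
  exists (m : nat) (Ks : 'I_m -> op Qin Qout) (c : C),
    [/\ forall k, local_op pin pout (Ks k),
        forall bo bo', sigma bo bo' = c * kraus Ks rho bo bo' &
        \sum_b sigma b b = 1].
Proof.
move=> [m [Ks [Kloc /= [t0 sigmaE]]]].
exists m, Ks, (\sum_b kraus_apply Ks rho b b)^-1; split=> //.
  by move=> bo bo'; rewrite sigmaE mulrC.
by rewrite (eq_bigr _ (fun b _ => sigmaE b b)) -mulr_suml divff.
Qed.

Lemma kraus_comp (I J Q1 Q2 Q3 : finType) (Ls : I -> op Q2 Q3) (Ks : J -> op Q1 Q2)
    (rho : op Q1 Q1) bo bo' :
  kraus (fun ij : I * J => comp_op (Ls ij.1) (Ks ij.2)) rho bo bo' =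
  kraus Ls (kraus Ks rho) bo bo'.
Proof.
rewrite /kraus /comp_op.
(* Both sides become the same sum over two input and two intermediate assignments; the rest is
   exchange of summations. *)
under [RHS]eq_bigr do (under eq_bigr do (under eq_bigr do
  rewrite mulr_sumr mulr_suml);
  under eq_bigr do rewrite exchange_big; rewrite exchange_big /=).
rewrite [RHS]pair_bigA /=; apply: eq_bigr => -[i j] _ /=.
under eq_bigr do under eq_bigr do
  (rewrite rmorph_sum mulr_suml mulr_suml;
   under eq_bigr do rewrite mulr_sumr).
under [RHS]eq_bigr do under eq_bigr do
  (rewrite mulr_sumr mulr_suml;
   under eq_bigr do rewrite mulr_sumr mulr_suml).
rewrite [RHS](eq_bigr (fun bm => \sum_b \sum_b' \sum_bm'
   (Ls i bo bm * (Ks j bm b * rho b b' * (Ks j bm' b')^*) * (Ls i bo' bm')^*))); last first.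
  move=> bm _; rewrite exchange_big; apply: eq_bigr => b _.
  by rewrite exchange_big.
rewrite [RHS]exchange_big; apply: eq_bigr => b _.
rewrite [RHS]exchange_big; apply: eq_bigr => b' _.
apply: eq_bigr => bm _; apply: eq_bigr => bm' _.
by rewrite rmorphM /=; ring.
Qed.

Lemma krausZ (I Qin Qout : finType) (Ks : I -> op Qin Qout) (rho : op Qin Qin) c bo bo' :
  kraus Ks (fun b b' => c * rho b b') bo bo' = c * kraus Ks rho bo bo'.
Proof.
rewrite /kraus mulr_sumr; apply: eq_bigr => k _; rewrite mulr_sumr.
apply: eq_bigr => b _; rewrite mulr_sumr; apply: eq_bigr => b' _.
by rewrite !mulrA (mulrC _ c).
Qed.

Lemma slocc_output_trans (P Q1 Q2 Q3 : finType) (p1 : Q1 -> P) (p2 : Q2 -> P)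
    (p3 : Q3 -> P) (rho : op Q1 Q1) (sigma : op Q2 Q2) (tau : op Q3 Q3) :
  slocc_output p1 p2 rho sigma -> slocc_output p2 p3 sigma tau ->
  slocc_output p1 p3 rho tau.
Proof.
move=> /slocc_outputE [m [Ks [c [Kloc sigmaE _]]]].
move=> /slocc_outputE [m' [Ls [c' [Lloc tauE tr1]]]].
apply: (@slocc_outputI _ _ _ _ _ _ _ _
  (fun ij : 'I_m' * 'I_m => comp_op (Ls ij.1) (Ks ij.2)) (c' * c)) => //.
  by move=> ij; apply: local_comp_op (Lloc _) (Kloc _).
move=> bo bo'; rewrite tauE kraus_comp -mulrA -(krausZ _ _ c).
by congr (_ * _); apply: eq_kraus.
Qed.

Lemma slocc_output_coarse (P P' Qin Qout : finType) (g : P -> P') (pin : Qin -> P)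
    (pout : Qout -> P) (rho : op Qin Qin) (sigma : op Qout Qout) :
  slocc_output pin pout rho sigma ->
  slocc_output (g \o pin) (g \o pout) rho sigma.
Proof.
move=> [m [Ks [Kloc H]]]; exists m, Ks; split=> // k.
exact: local_coarse.
Qed.

(** An assignment on [n] copies is a function from copies to assignments, so this is
    distributivity. *)
Lemma sum_prod_slice (Q : finType) (n : nat) (F : 'I_n -> basis Q -> C) :
  \sum_(b : basis (Q * 'I_n)%type) \prod_k F k (slice b k) = \prod_k \sum_b F k b.
Proof.
rewrite bigA_distr_bigA /=.
rewrite [RHS](reindex (fun b : basis (Q * 'I_n)%type => [ffun k => slice b k])) /=.
  by apply: eq_bigr => b _; apply: eq_bigr => k _; rewrite ffunE.
apply: onW_bij; exists (fun f : {ffun 'I_n -> basis Q} => [ffun x => f x.2 x.1]).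
  by move=> b; apply/ffunP=> -[q k]; rewrite !ffunE.
by move=> f; apply/ffunP=> k; apply/ffunP=> q; rewrite !ffunE.
Qed.

(** The protocol runs independently on each copy; a joint Kraus operator is a choice [f] of one
    branch per copy. *)
Lemma slocc_output_copies (P Qin Qout : finType) (pin : Qin -> P) (pout : Qout -> P)
    (rho : op Qin Qin) (sigma : op Qout Qout) (n : nat) :
  slocc_output pin pout rho sigma ->
  slocc_output (fun x : (Qin * 'I_n)%type => pin x.1)
    (fun x : (Qout * 'I_n)%type => pout x.1) (copies rho n) (copies sigma n).
Proof.
move=> /slocc_outputE [m [Ks [c [Kloc sigmaE tr1]]]].
apply: (@slocc_outputI _ _ _ _ _ _ _ _
  (fun f : {ffun 'I_n -> 'I_m} => tensor_op (fun k => Ks (f k))) (c ^+ n)).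
- by move=> f; apply: local_tensor_op.
- move=> bo bo'; rewrite /copies (eq_bigr _ (fun k _ => sigmaE _ _)) big_split /=.
  rewrite prodr_const card_ord; congr (_ * _).
  rewrite /kraus bigA_distr_bigA /=; apply: eq_bigr => f _.
  rewrite -(sum_prod_slice (fun k bi => \sum_bi'
    Ks (f k) (slice bo k) bi * rho bi bi' * (Ks (f k) (slice bo' k) bi')^*)).
  apply: eq_bigr => bi _.
  rewrite -(sum_prod_slice (fun k bi' =>
    Ks (f k) (slice bo k) (slice bi k) * rho (slice bi k) bi' * (Ks (f k) (slice bo' k) bi')^*)).
  by apply: eq_bigr => bi' _; rewrite !big_split rmorph_prod.
- by rewrite /copies (sum_prod_slice (fun _ b => sigma b b)) big1.
Qed.

Lemma slocc_output_reindex (P Q Q' Qout : finType) (h : Q' -> Q) (pin : Q -> P)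
    (pout : Qout -> P) (rho : op Q Q) (rho' : op Q' Q') (sigma : op Qout Qout) :
  bijective h ->
  (forall b b' : basis Q, rho' [ffun x => b (h x)] [ffun x => b' (h x)] = rho b b') ->
  slocc_output pin pout rho sigma -> slocc_output (pin \o h) pout rho' sigma.
Proof.
move=> [g hK gK] rhoE /slocc_outputE [m [Ks [c [Kloc sigmaE tr1]]]].
pose pull (b : basis Q) : basis Q' := [ffun x => b (h x)].
pose push (b : basis Q') : basis Q := [ffun x => b (g x)].
have pullK : cancel pull push by move=> b; apply/ffunP=> x; rewrite !ffunE gK.
have pushK : cancel push pull by move=> b; apply/ffunP=> x; rewrite !ffunE hK.
have pull_bij : bijective pull by exists push.
apply: (@slocc_outputI _ _ _ _ _ _ _ _ (fun k bo bi => Ks k bo (push bi)) c) => //.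
  move=> k; apply/local_opP; have /local_opP [A [Aloc KE]] := Kloc k.
  exists (fun p bo bi => A p bo (push bi)); split=> // p bo bo' bi bi' Ho Hi.
  by apply: Aloc => // x Hx; rewrite !ffunE; apply: Hi; rewrite /= gK.
move=> bo bo'; rewrite sigmaE; congr (_ * _); apply: eq_bigr => k _.
rewrite [RHS](reindex _ (onW_bij _ pull_bij)); apply: eq_bigr => b _.
rewrite [RHS](reindex _ (onW_bij _ pull_bij)); apply: eq_bigr => b' _.
by rewrite !pullK rhoE.
Qed.

(** Pairs of copy indices are flattened by enumeration, which leaves the holder of each qubit
    unchanged. *)
Lemma slocc_output_copiesM (P Q Qout : finType) (pi : Q -> P) (pout : Qout -> P)
    (rho : op Q Q) (sigma : op Qout Qout) (n m : nat) :
  slocc_output (fun x : ((Q * 'I_n) * 'I_m)%type => pi x.1.1) pout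
    (copies (copies rho n) m) sigma ->
  slocc_output (fun x : (Q * 'I_#|{: 'I_n * 'I_m}|)%type => pi x.1) pout
    (copies rho #|{: 'I_n * 'I_m}|) sigma.
Proof.
pose h (x : (Q * 'I_#|{: 'I_n * 'I_m}|)%type) :=
  ((x.1, (enum_val x.2).1), (enum_val x.2).2).
apply: (slocc_output_reindex (h := h)) => [|b b'].
  exists (fun y => (y.1.1, enum_rank (y.1.2, y.2))).
    by move=> [q k]; rewrite /h /= -surjective_pairing enum_valK.
  by move=> [[q i] j]; rewrite /h /= enum_rankK.
rewrite /copies exchange_big pair_bigA /=.
rewrite [RHS](reindex _ (onW_bij _ (@enum_val_bij ('I_n * 'I_m)%type))) /=.
by apply: eq_bigr => k _; congr (rho _ _); apply/ffunP=> q; rewrite !ffunE.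
Qed.

(** * Norm estimates *)

Definition dot (Q : finType) (u v : vec Q) : C := \sum_b (u b)^* * v b.
Definition normsq (Q : finType) (v : vec Q) : C := \sum_b `|v b| ^+ 2.

Lemma normsq_ge0 (Q : finType) (v : vec Q) : 0 <= normsq v.
Proof. by apply: sumr_ge0 => b _; rewrite exprn_ge0. Qed.

(** The real parameter [s] serves two cases: [s = 1] with [u] a unit vector gives Pythagoras, and
    [s = normsq u] gives Cauchy-Schwarz without division. *)
Lemma normsq_residual (Q : finType) (u v : vec Q) (s : C) :
  s^* = s ->
  normsq (fun b => s * v b - dot u v * u b) =
  s ^+ 2 * normsq v - (2 * s - normsq u) * `|dot u v| ^+ 2.
Proof.
move=> sR; set a := dot u v.
have aE : a^* = \sum_b u b * (v b)^*.
  by rewrite /a /dot rmorph_sum; apply: eq_bigr => b _; rewrite rmorphM /= conjCK.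
have aD : dot u v = a by []. clearbody a.
transitivity (s ^+ 2 * normsq v - s * a * (\sum_b u b * (v b)^*)
    - s * a^* * dot u v + a * a^* * normsq u).
  rewrite /normsq /dot !mulr_sumr -!sumrB -big_split /=.
  apply: eq_bigr => b _; rewrite !normCK rmorphB !rmorphM /= sR; ring.
by rewrite -aE aD normCK; ring.
Qed.

Lemma normsq_project (Q : finType) (u v : vec Q) :
  normsq u = 1 ->
  normsq (fun b => v b - dot u v * u b) = normsq v - `|dot u v| ^+ 2.
Proof.
move=> u1; rewrite -[RHS]mul1r.
have := normsq_residual u v (rmorph1 _ : 1^* = 1 :> C).
rewrite u1 => H; rewrite mul1r -[normsq v]mul1r -(expr1n _ 2).
transitivity (normsq (fun b => 1 * v b - dot u v * u b)).
  by apply: eq_bigr => b _; rewrite mul1r.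
by rewrite H; ring.
Qed.

Lemma normsq_dot_le (Q : finType) (u v : vec Q) :
  `|dot u v| ^+ 2 <= normsq u * normsq v.
Proof.
have u_ge0 := normsq_ge0 u.
have [u0|u_neq0] := eqVneq (normsq u) 0.
  rewrite u0 mul0r [dot u v]big1 ?normr0 ?expr0n // => b _.
  have /eqP := psumr_eq0P (fun b _ => exprn_ge0 2 (normr_ge0 (u b))) u0 (i := b) isT.
  by rewrite expf_eq0 normr_eq0 => /andP[_ /eqP ->]; rewrite rmorph0 mul0r.
have u_gt0 : 0 < normsq u by rewrite lt_def u_neq0.
have uR : (normsq u)^* = normsq u by apply/CrealP/ger0_real.
have := normsq_ge0 (fun b => normsq u * v b - dot u v * u b).
rewrite normsq_residual // => H; rewrite -subr_ge0.
rewrite -(pmulr_rge0 _ u_gt0); apply: le_trans H _; rewrite le_eqVlt; apply/orP; left.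
by apply/eqP; ring.
Qed.

Definition apply_op (Qin Qout : finType) (K : op Qin Qout) (v : vec Qin) : vec Qout :=
  fun bo => \sum_bi K bo bi * v bi.

Definition hs_normsq (Qin Qout : finType) (K : op Qin Qout) : C :=
  \sum_bo normsq (K bo).

(** Cauchy-Schwarz on each row of [K]. The Hilbert-Schmidt norm is a crude bound, but any constant
    depending on [K] alone suffices. *)
Lemma normsq_apply_le (Qin Qout : finType) (K : op Qin Qout) (v : vec Qin) :
  normsq (apply_op K v) <= hs_normsq K * normsq v.
Proof.
rewrite /hs_normsq mulr_suml; apply: ler_sum => bo _.
have -> : apply_op K v bo = dot (fun bi => (K bo bi)^*) v.
  by apply: eq_bigr => bi _; rewrite conjCK.
apply: le_trans (normsq_dot_le _ _) _.
rewrite le_eqVlt; apply/orP; left; apply/eqP; congr (_ * _).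
by apply: eq_bigr => bi _; rewrite norm_conjC.
Qed.

(* [s] is the amplitude on [phi] of the image of the part of [w] orthogonal to [psi]. *)
Lemma overlap_apply (Qin Qout : finType) (K : op Qin Qout) (psi : vec Qin)
    (phi : vec Qout) (c : C) (w : vec Qin) :
  normsq psi = 1 -> normsq phi = 1 ->
  (forall b, apply_op K psi b = c * phi b) ->
  let s := dot phi (apply_op K w) - c * dot psi w in
  normsq (apply_op K w) - `|dot phi (apply_op K w)| ^+ 2 + `|s| ^+ 2
    <= hs_normsq K * (normsq w - `|dot psi w| ^+ 2).
Proof.
(* Let [r] be the part of [w] orthogonal to [psi]. As [K] sends [psi] to a multiple of [phi], the
   images of [r] and [w] have the same part orthogonal to [phi], and the image of [r] has overlap
   [s] with [phi]. *)
move=> psi1 phi1 Kpsi /=; set s := _ - c * _.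
rewrite -(normsq_project w psi1); set r : vec Qin := fun b => _ - _.
apply: le_trans (normsq_apply_le K r).
have KrE b : apply_op K r b = apply_op K w b - c * dot psi w * phi b.
  rewrite mulrAC -Kpsi /apply_op mulr_suml -sumrB.
  by apply: eq_bigr => b' _; rewrite mulrBr; congr (_ - _); ring.
have sE : dot phi (apply_op K r) = s.
  rewrite /s /dot -/(dot psi w).
  rewrite -[c * _]mulr1 -phi1 [normsq phi]/normsq mulr_sumr -sumrB.
  by apply: eq_bigr => b _; rewrite KrE normCK; ring.
rewrite -sE -(normsq_project (apply_op K w) phi1).
rewrite -lerBrDr -(normsq_project (apply_op K r) phi1).
rewrite le_eqVlt; apply/orP; left; apply/eqP; apply: eq_bigr => b _.
by rewrite sE KrE /s; congr (`| _ | ^+ 2); ring.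
Qed.

(** The difference of the two sides is the squared modulus of [x + 2 * y]. *)
Lemma ler_normsqB (x y : C) : `|x| ^+ 2 <= 2 * `|x + y| ^+ 2 + 2 * `|y| ^+ 2.
Proof.
rewrite -subr_ge0 !normCK.
suff -> : 2 * ((x + y) * (x + y)^*) + 2 * (y * y^*) - x * x^*
  = (x + 2 * y) * (x + 2 * y)^*.
  exact: mul_conjC_ge0.
by rewrite !rmorphD rmorphM rmorph_nat /=; ring.
Qed.

(** * From the graph state to a Bell pair *)

Lemma basis_sum_bool (F : basis bool -> C) :
  \sum_b F b = \sum_(x : bool) \sum_(y : bool) F [ffun z => if z then y else x].
Proof.
rewrite pair_bigA /= (reindex (fun p : bool * bool => [ffun z : bool => if z then p.2 else p.1])) //.
apply: onW_bij; exists (fun b : basis bool => (b false, b true)).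
  by move=> [x y]; rewrite !ffunE.
by move=> b; apply/ffunP=> -[]; rewrite !ffunE.
Qed.

Lemma normsq_bell : normsq bell = 1.
Proof.
rewrite /normsq basis_sum_bool !big_bool /bell !ffunE /= normr0 expr0n /=.
rewrite normfV exprVn ger0_norm ?sqrtC_ge0 ?ler0n // sqrtCK addr0 add0r.
by rewrite -mulr2n -(mulr_natl _^-1 2) mulfV ?pnatr_eq0.
Qed.

(** Edge phases are signs, so all [2 ^ #|V|] amplitudes have the same modulus. *)
Lemma normsq_graph_state (V : finType) (e : rel V) : normsq (graph_state e) = 1.
Proof.
have E b : `|graph_state e b| ^+ 2 = (2 ^+ #|V|)^-1.
  rewrite /graph_state normrM exprMn normfV exprVn normrX -exprM mulnC exprM.
  rewrite (ger0_norm _) ?sqrtC_ge0 ?ler0n // sqrtCK normr_prod big1 ?expr1n ?mulr1 // => E _.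
  by case: ifP => _; rewrite ?normrN normr1.
rewrite /normsq (eq_bigr _ (fun b _ => E b)) sumr_const card_ffun card_bool.
by rewrite -[_ *+ _]mulr_natl natrX mulfV ?expf_neq0 ?pnatr_eq0.
Qed.

Section Edge.

Variables (V : finType) (e : rel V) (x y : V).

(* [<0|] on every qubit other than [x] and [y], identity on [x], Hadamard on [y] *)
Definition edge_op : op V bool := fun bo bi =>
  ([forall v, bi v ==> ((v == x) || (v == y))] && (bo false == bi x))%:R
  * ((sqrtC 2)^-1 * (if bo true && bi y then -1 else 1)).

Lemma local_edge_op (side : V -> bool) :
  side x = false -> side y = true -> local_op side id edge_op.
Proof.
move=> sx sy; apply/local_opP.
(* The projection onto zeros is a conjunction over qubits, hence splits into one condition per
   side. *)
pose Z p (bi : basis V) := [forall v, (side v == p) && bi v ==> ((v == x) || (v == y))].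
have ZE p bi bi' : agree side p bi bi' -> Z p bi = Z p bi'.
  by move=> H; apply: eq_forallb => v; case: eqP => //= /H ->.
exists (fun p bo bi => if p
  then (Z true bi)%:R * ((sqrtC 2)^-1 * (if bo true && bi y then -1 else 1))
  else (Z false bi && (bo false == bi x))%:R); split.
  case=> bo bo' bi bi' Ho Hi; rewrite (ZE _ _ _ Hi).
    by rewrite (Ho true) // (Hi y).
  by rewrite (Ho false) // (Hi x).
move=> bo bi; rewrite big_bool /= /edge_op.
have -> : [forall v, bi v ==> ((v == x) || (v == y))] = Z true bi && Z false bi.
  apply/forallP/andP=> [H|[/forallP Ht /forallP Hf] v].
    by split; apply/forallP=> v; apply/implyP=> /andP[_]; apply/implyP.
  by have := Ht v; have := Hf v; case: (side v).
by case: (Z true bi); case: (Z false bi); case: (_ == _); rewrite /= ?mul1r ?mulr1 ?mul0r ?mulr0.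
Qed.

Hypotheses (e_irr : irreflexive e) (exy : e x y).

Let neq_xy : x != y.
Proof. by apply: contraTneq exy => ->; rewrite e_irr. Qed.

Let pair (s t : bool) : basis V :=
  [ffun v => if v == x then s else if v == y then t else false].

(** With all bits off [x] and [y] zero, only the edge between them can contribute a sign;
    irreflexivity excludes loops at [x] or [y]. *)
Lemma graph_state_pair s t :
  graph_state e (pair s t) = ((sqrtC 2) ^+ #|V|)^-1 * (if s && t then -1 else 1).
Proof.
rewrite /graph_state; congr (_ * _).
have xyE : [set x; y] \in edges e.
  by rewrite inE; apply/existsP; exists x; apply/existsP; exists y; rewrite exy eqxx.
rewrite (bigD1 _ xyE) /= big1 ?mulr1 => [|E /andP[HE neq]].
  congr (if _ then _ else _); apply/forall_inP/andP => [H|[-> ->] v].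
    have := H x; have := H y.
    by rewrite !inE !ffunE !eqxx orbT eq_sym (negbTE neq_xy); move=> /(_ isT) -> /(_ isT) ->.
  by rewrite !inE !ffunE => /orP[]/eqP->; rewrite eqxx // eq_sym (negbTE neq_xy).
have := HE : E \in edges e; rewrite inE => /existsP[u /existsP[v /andP[euv /eqP EE]]].
rewrite {}EE {HE} in neq *.
case: ifP => // /forall_inP H; case/eqP: neq.
have bu : pair s t u by apply: H; rewrite !inE eqxx.
have bv : pair s t v by apply: H; rewrite !inE eqxx orbT.
have neq_uv : u != v by apply: contraTneq euv => ->; rewrite e_irr.
have sup w : pair s t w -> (w == x) || (w == y).
  by rewrite ffunE; case: (w == x); case: (w == y).
case/orP: (sup u bu) neq_uv => /eqP->; case/orP: (sup v bv) => /eqP->; rewrite ?eqxx //.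
by move=> _; apply: setUC.
Qed.

(** The surviving amplitudes carry the controlled-phase signs. Summing over the bit of [y] against
    the Hadamard signs cancels unless the output bits agree, where two equal terms give the factor
    2. *)
Lemma edge_op_graph_state b :
  apply_op edge_op (graph_state e) b = (2 / (sqrtC 2) ^+ #|V|) * bell b.
Proof.
rewrite /apply_op (bigID (fun bi : basis V =>
  [forall v, bi v ==> ((v == x) || (v == y))])) /= [X in _ + X]big1 ?addr0; last first.
  by move=> bi /negbTE H; rewrite /edge_op H /= !mul0r.
rewrite (reindex_onto (fun p : bool * bool => pair p.1 p.2)
  (fun bi => (bi x, bi y))) /=; last first.
  move=> bi /forallP H; apply/ffunP=> v; rewrite ffunE.
  case: eqP => [->//|/eqP vx]; case: eqP => [->//|/eqP vy].
  by have := H v; rewrite (negbTE vx) (negbTE vy) implybF => /negbTE ->.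
have pairx s t : pair s t x = s by rewrite ffunE eqxx.
have pairy s t : pair s t y = t by rewrite ffunE eq_sym (negbTE neq_xy) eqxx.
have sup s t : [forall v, pair s t v ==> ((v == x) || (v == y))].
  by apply/forallP=> v; rewrite ffunE; case: (v == x); case: (v == y); rewrite ?implybT.
rewrite (eq_bigl predT) => [|[s t]]; last by rewrite /= sup pairx pairy eqxx.
rewrite -(pair_bigA _ (fun s t => edge_op b (pair s t) * graph_state e (pair s t))) /=.
rewrite !big_bool /= /edge_op !graph_state_pair !sup !pairx !pairy /= /bell.
set r := (sqrtC 2)^-1; set q := (_ ^+ _)^-1.
by case: (b false); case: (b true); rewrite /=; ring.
Qed.

End Edge.

(** Along a path from [u] to [v], the first vertex where [f] is true is entered by a crossing
    edge. *)
Lemma connect_cross (V : finType) (e : rel V) (f : V -> bool) u v :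
  connect e u v -> f u = false -> f v = true ->
  exists x y, [/\ e x y, f x = false & f y = true].
Proof.
move=> /connectP[p + ->]; elim: p u => [|w p IH] u /=; first by move=> _ ->.
move=> /andP[euw pw] fu; case fw: (f w); last exact: IH.
by exists u, w.
Qed.

(** * Fidelity of the filtered state *)

(** Positivity in factored form: weights are absorbed into the vectors, and no spectral
    decomposition is needed. *)
Definition is_mixture (Q : finType) (sigma : op Q Q) :=
  exists (I : finType) (w : I -> vec Q),
    forall b b', sigma b b' = \sum_i w i b * (w i b')^*.

Lemma mixture_noisy_graph_state (V : finType) (e : rel V) (lam : basis V -> C) :
  (forall j, 0 <= lam j) -> is_mixture (noisy_graph_state e lam).
Proof.
move=> lam_ge0.
exists (basis V), (fun j b => sqrtC (lam j) * (zsign j b * graph_state e b)) => b b'.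
(* The square root of a nonnegative weight is real, so conjugation fixes it. *)
apply: eq_bigr => j _; have := sqrtC_ge0 (lam j); rewrite lam_ge0 => /ger0_real/CrealP sR.
by rewrite [in RHS]rmorphM /= sR -{1}(sqrtCK (lam j)); ring.
Qed.

Lemma mixture_copies (Q : finType) (rho : op Q Q) (n : nat) :
  is_mixture rho -> is_mixture (copies rho n).
Proof.
move=> [I [w rhoE]].
exists {ffun 'I_n -> I}, (fun (f : {ffun 'I_n -> I}) b => \prod_k w (f k) (slice b k)) => b b'.
rewrite /copies (eq_bigr _ (fun k _ => rhoE _ _)) bigA_distr_bigA /=.
by apply: eq_bigr => f _; rewrite big_split rmorph_prod.
Qed.

Lemma trace_mixture (I Q : finType) (sigma : op Q Q) (w : I -> vec Q) :
  (forall b b', sigma b b' = \sum_i w i b * (w i b')^*) ->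
  \sum_b sigma b b = \sum_i normsq (w i).
Proof.
move=> sigmaE; rewrite (eq_bigr _ (fun b _ => sigmaE b b)) exchange_big.
by apply: eq_bigr => i _; apply: eq_bigr => b _; rewrite normCK.
Qed.

Lemma expval_mixture (I Q : finType) (sigma : op Q Q) (w : I -> vec Q) (psi : vec Q) :
  (forall b b', sigma b b' = \sum_i w i b * (w i b')^*) ->
  expval psi sigma = \sum_i `|dot psi (w i)| ^+ 2.
Proof.
move=> sigmaE; rewrite /expval.
transitivity (\sum_i \sum_b \sum_b' (psi b)^* * (w i b * (w i b')^*) * psi b').
  rewrite [RHS]exchange_big; apply: eq_bigr => b _.
  rewrite [RHS]exchange_big; apply: eq_bigr => b' _.
  by rewrite sigmaE mulr_sumr mulr_suml.
apply: eq_bigr => i _; rewrite normCK /dot rmorph_sum mulr_suml.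
apply: eq_bigr => b _; rewrite mulr_sumr; apply: eq_bigr => b' _.
by rewrite rmorphM /= conjCK; ring.
Qed.

Lemma kraus_mixture (I J Qin Qout : finType) (Ks : J -> op Qin Qout)
    (rho : op Qin Qin) (w : I -> vec Qin) bo bo' :
  (forall b b', rho b b' = \sum_i w i b * (w i b')^*) ->
  kraus Ks rho bo bo' =
  \sum_(ji : J * I) apply_op (Ks ji.1) (w ji.2) bo * (apply_op (Ks ji.1) (w ji.2) bo')^*.
Proof.
move=> rhoE.
rewrite -(pair_bigA _ (fun j i => apply_op (Ks j) (w i) bo * (apply_op (Ks j) (w i) bo')^*)) /=.
apply: eq_bigr => j _.
transitivity (\sum_i \sum_b \sum_b' Ks j bo b * (w i b * (w i b')^*) * (Ks j bo' b')^*).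
  rewrite [RHS]exchange_big; apply: eq_bigr => b _.
  rewrite [RHS]exchange_big; apply: eq_bigr => b' _.
  by rewrite rhoE mulr_sumr mulr_suml.
apply: eq_bigr => i _; rewrite /apply_op rmorph_sum mulr_suml.
apply: eq_bigr => b _; rewrite mulr_sumr; apply: eq_bigr => b' _.
by rewrite rmorphM /=; ring.
Qed.

(** Every Kraus operator maps every ensemble vector to a new one; the normalisation [t] is a trace
    of a mixture, hence nonnegative, and its inverse square root rescales the vectors. *)
Lemma mixture_slocc_output (P Qin Qout : finType) (pin : Qin -> P) (pout : Qout -> P)
    (rho : op Qin Qin) (sigma : op Qout Qout) :
  slocc_output pin pout rho sigma -> is_mixture rho -> is_mixture sigma.
Proof.
move=> [m [Ks [_ /= [_ sigmaE]]]] [I [w rhoE]].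
have KE bo bo' := kraus_mixture Ks bo bo' rhoE.
set t := \sum_b _ in sigmaE.
have t_ge0 : 0 <= t.
  by rewrite /t (trace_mixture KE); apply: sumr_ge0 => ji _; apply: normsq_ge0.
have := sqrtC_ge0 t^-1; rewrite invr_ge0 t_ge0 => /ger0_real/CrealP sR.
exists ('I_m * I)%type, (fun ji b => sqrtC t^-1 * apply_op (Ks ji.1) (w ji.2) b) => b b'.
rewrite sigmaE (KE b b' : kraus_apply Ks rho b b' = _) mulr_suml; apply: eq_bigr => ji _.
by rewrite rmorphM /= sR -{1}(sqrtCK t^-1); ring.
Qed.

(* [N] and [D] are the unnormalised overlap and the norm after the filter, [F] the
   fidelity before it, [q] the squared amplitude that the filter gives the target, [S] the
   overlap created by the part orthogonal to the target. *)
Lemma filter_fidelity_bound (eps q M F N D S : C) :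
  0 < eps -> 0 < q -> 0 <= M -> 0 <= N -> 0 <= S -> N <= D ->
  1 - eps * q / (4 * (M + q) * (1 + eps)) <= F ->
  q * F <= 2 * N + 2 * S -> D - N + S <= M * (1 - F) ->
  0 < D /\ 1 - eps <= N / D.
Proof.
move=> eps0 q0 M0 N0 S0 ND HF HqF HM.
have Mq0 : 0 < M + q by rewrite ltr_wpDl.
have eps1 : 0 < 1 + eps by rewrite addr_gt0.
set d := eps * q / _ in HF.
(* The tolerance [d] is chosen exactly so that this margin is positive. *)
have B0 : 0 < eps * q * (1 - d) / 2 - (1 + eps) * M * d.
  have -> : eps * q * (1 - d) / 2 - (1 + eps) * M * d
      = eps * q * (2 * M * (1 + eps) + 4 * q + 3 * eps * q) / (8 * (M + q) * (1 + eps)).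
    by rewrite /d; field; rewrite !gt_eqF.
  rewrite divr_gt0 ?mulr_gt0 ?ltr0n //.
  by rewrite addr_gt0 ?mulr_gt0 ?ltr0n // ltr_wpDl ?mulr_gt0 ?mulr_ge0 ?ltr0n // ltW.
have HMd : D - N + S <= M * d.
  by apply: le_trans HM _; rewrite ler_wpM2l // lerBlDr addrC -lerBlDr.
(* The margin plus a combination of the hypotheses with nonnegative coefficients. *)
have key : 0 < eps * N - (D - N).
  have -> : eps * N - (D - N) = (eps * q * (1 - d) / 2 - (1 + eps) * M * d)
     + (eps / 2 * (2 * N + 2 * S - q * F) + eps * q / 2 * (F - (1 - d))
     + (1 + eps) * (M * d - (D - N + S)) + eps * (D - N) + S) by field.
  rewrite ltr_pwDl // addr_ge0 // !addr_ge0 // mulr_ge0 ?subr_ge0 //.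
  - by rewrite divr_ge0 ?ler0n // ltW.
  - by rewrite divr_ge0 ?ler0n // mulr_ge0 // ltW.
  - exact: ltW.
  - exact: ltW.
have N_gt0 : 0 < N.
  rewrite -(pmulr_rgt0 _ eps0); apply: lt_le_trans key _.
  by rewrite lerBlDr lerDl subr_ge0.
have D0 := lt_le_trans N_gt0 ND.
split=> //; rewrite ler_pdivlMr // -subr_ge0.
have -> : N - (1 - eps) * D = eps * N - (D - N) + eps * (D - N) by ring.
apply: addr_ge0; first exact: ltW.
by rewrite mulr_ge0 ?subr_ge0 // ltW.
Qed.

(** Here [delta] depends on [K], [c] and [eps] but not on [sigma], so it can be fixed before a
    purification protocol is chosen. The per-vector estimates are summed over the ensemble. *)
Lemma filter_fidelity (P Qin Qout : finType) (pin : Qin -> P) (pout : Qout -> P)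
    (K : op Qin Qout) (psi : vec Qin) (phi : vec Qout) (c eps : C) :
  local_op pin pout K -> normsq psi = 1 -> normsq phi = 1 ->
  (forall b, apply_op K psi b = c * phi b) -> c != 0 -> 0 < eps ->
  exists2 delta, 0 < delta &
    forall sigma, is_mixture sigma -> \sum_b sigma b b = 1 ->
      1 - delta <= expval psi sigma ->
      exists2 tau, slocc_output pin pout sigma tau & 1 - eps <= expval phi tau.
Proof.
move=> Kloc psi1 phi1 Kpsi c0 eps0.
set q := `|c| ^+ 2; set M := hs_normsq K.
have q0 : 0 < q by rewrite exprn_gt0 // normr_gt0.
have M0 : 0 <= M by apply: sumr_ge0 => b _; apply: normsq_ge0.
exists (eps * q / (4 * (M + q) * (1 + eps))).
  have Mq0 : 0 < M + q by rewrite ltr_wpDl.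
  have eps1 : 0 < 1 + eps by rewrite addr_gt0.
  by rewrite divr_gt0 ?mulr_gt0 ?ltr0n ?normr_gt0 .
move=> sigma [I [w sigmaE]] tr1 HF.
rewrite (expval_mixture psi sigmaE) in HF; rewrite (trace_mixture sigmaE) in tr1.
pose y i := apply_op K (w i); pose s i := dot phi (y i) - c * dot psi (w i).
have KE bo bo' := kraus_mixture (fun _ : unit => K) bo bo' sigmaE.
have KtE bo bo' : kraus (fun _ : unit => K) sigma bo bo' = \sum_i y i bo * (y i bo')^*.
  rewrite KE -(pair_bigA _ (fun _ i => y i bo * (y i bo')^*)) /=.
  by rewrite sumr_const card_unit.
have ler_sumI (f g : I -> C) : (forall i, f i <= g i) -> \sum_i f i <= \sum_i g i.
  by move=> fg; apply: ler_sum => i _.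
have [|||||D0 fid] := @filter_fidelity_bound eps q M _ (\sum_i `|dot phi (y i)| ^+ 2)
   (\sum_i normsq (y i)) (\sum_i `|s i| ^+ 2) eps0 q0 M0 _ _ _ HF.
- by apply: sumr_ge0 => i _; rewrite exprn_ge0.
- by apply: sumr_ge0 => i _; rewrite exprn_ge0.
- by apply: ler_sumI => i; have := normsq_dot_le phi (y i); rewrite phi1 mul1r.
(* The overlap after the filter is [c * dot psi (w i)] plus [s i]; this bounds the first summand. *)
- rewrite !mulr_sumr -big_split; apply: ler_sumI => i /=.
  have := ler_normsqB (c * dot psi (w i)) (s i).
  by rewrite /s [c * _ + _]addrC subrK normrM exprMn.
(* Unit trace writes [1 - F] as the total weight orthogonal to [psi]. *)
- rewrite -tr1 -!sumrB mulr_sumr -big_split; apply: ler_sumI => i /=.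
  exact: overlap_apply.
pose D := \sum_i normsq (y i).
exists (fun bo bo' => D^-1 * kraus (fun _ : unit => K) sigma bo bo').
  apply: slocc_outputI => // ; first exact: (fun _ => Kloc).
  by rewrite -mulr_sumr (trace_mixture KtE) mulVf // gt_eqF.
apply: le_trans fid _; rewrite -(expval_mixture phi KtE) /expval mulr_suml.
rewrite le_eqVlt; apply/orP; left; apply/eqP; apply: eq_bigr => b _.
by rewrite mulr_suml; apply: eq_bigr => b' _; rewrite -/D; ring.
Qed.

Theorem theorem1 (V : finType) (e : rel V) (side : V -> bool)
  (rho2 : op bool bool) (lam : basis V -> C) :
  symmetric e -> irreflexive e ->
  (forall x y : V, connect e x y) ->
  (1 < #|V|)%N ->
  (exists v, side v = false) -> (exists v, side v = true) ->
  is_density rho2 ->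
  (forall j, 0 <= lam j) -> \sum_(j : basis V) lam j = 1 ->
  (exists n : nat,
     slocc_output (fun x : (bool * 'I_n)%type => x.1) side
       (copies rho2 n) (noisy_graph_state e lam)) ->
  ~ purifiable rho2 bell ->
  ~ purifiable (noisy_graph_state e lam) (graph_state e).
Proof.
move=> _ e_irr e_conn _ [u su] [v sv] _ lam_ge0 _ [n prep] not_pur pur; apply: not_pur.
have [x [y [exy sx sy]]] := connect_cross (e_conn u v) su sv.
move=> eps eps0.
have c0 : 2 / sqrtC 2 ^+ #|V| != 0 :> C.
  by rewrite mulf_neq0 ?invr_eq0 ?expf_neq0 ?sqrtC_eq0 ?pnatr_eq0.
have [delta delta0 filter] := filter_fidelity (local_edge_op sx sy)
  (normsq_graph_state e) normsq_bell (edge_op_graph_state e_irr exy) c0 eps0.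
(* The purification of the graph state is invoked at the tolerance that the filter demands. *)
have [m [sigma [distill fid]]] := pur _ delta0.
have sigma_mix := mixture_slocc_output distill
  (mixture_copies m (mixture_noisy_graph_state e lam_ge0)).
have [_ [_ [_ [_ _ tr1]]]] := slocc_outputE distill.
have [tau extract fid'] := filter sigma sigma_mix tr1 fid.
(* Each of the [m] noisy graph states costs [n] copies of [rho2]. The protocol prepares them,
   purifies with parties merged into Alice and Bob, then filters. *)
exists #|{: 'I_n * 'I_m}|, tau; split=> //.
apply: (slocc_output_copiesM (pi := id)).
apply: slocc_output_trans (slocc_output_copies m prep) _.
exact: slocc_output_trans (slocc_output_coarse side distill) extract.
Qed.
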